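(* Let $b\in\{2,3\}$, let $D:=b^2-4b$, and let $p\ge 3$ be a prime such that $D\not\equiv 0\pmod{p}$. Then the trinomial $\mathcal{G}_{p,b}(x):=x^{2p}+bx^p+b$ is not monogenic if and only if $b^{p-1}\equiv 1\pmod{p^2}$.
   Context: A monic polynomial $f(x)\in\mathbb{Z}[x]$ of degree $N\ge 2$ is called monogenic if $f(x)$ is irreducible over $\mathbb{Q}$ and $\{1,\theta,\theta^2,\ldots,\theta^{N-1}\}$ is a basis (over $\mathbb{Z}$) for the ring of integers of $\mathbb{Q}(\theta)$, where $f(\theta)=0$. *)

(* Defs.v *)
From HB Require Import structures.
From mathcomp Require Import all_boot all_order all_algebra all_field.

Set Implicit Arguments.
Unset Strict Implicit.
Unset Printing Implicit Defensive.

Import GRing.Theory.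

Local Open Scope ring_scope.

Definition ring_of_integers (L : fieldExtType rat) (K : {subfield L}) (x : L) :
    Prop :=
  x \in K /\ integralOver (intr : int -> L) x.

Definition Z_basis (V : zmodType) (M : V -> Prop) (n : nat) (e : 'I_n -> V) :
    Prop :=
  [/\ forall i, M (e i),
      forall c : 'I_n -> int, \sum_i e i *~ c i = 0 -> forall i, c i = 0 &
      forall x, M x -> exists c : 'I_n -> int, x = \sum_i e i *~ c i].

(* The quantification over (L, theta) is never vacuous: an irreducible f has a
   root in some finite extension of rat, see irredp_FAdjoin.  Here <<1; theta>>
   is Q(theta), which may be a proper subfield of L. *)
Definition monogenic (f : {poly int}) : Prop :=
  [/\ f \is monic,
      (2 <= (size f).-1)%N,
      irreducible_poly (map_poly intr f : {poly rat}) &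
      forall (L : fieldExtType rat) (theta : L),
        root (map_poly intr f) theta ->
        Z_basis (ring_of_integers <<1; theta>>%AS)
          (fun i : 'I_(size f).-1 => theta ^+ i)].

Definition trinomial_G (p : nat) (b : int) : {poly int} :=
  'X^(2 * p) + b *: 'X^p + b%:P.

(* Main.v *)
(* Write f = x^(2p) + b x^p + b and g = x^2 + b x + b.  The criterion used at a
   prime q is: if f = G^e + q F with G squarefree mod q and F coprime to G mod q,
   then Z[theta] is q-maximal.  It applies at b with G = x (f is Eisenstein), and
   at every prime other than p and b with G = f - q (f is separable there).
   At p, f = g^p mod p.  Modulo g, x^24 = b^12; more precisely x^p = w y mod g
   where y is one of the two roots x, -b-x of g in Z[x]/g, and w^2 = b^(p-1).
   Hence f = g(w y) = b (1 - w) (w y + 1 + w) mod g, which forces p | 1 - w, and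
   the criterion holds at p if and only if p^2 does not divide 1 - w, that is,
   if and only if b^(p-1) <> 1 mod p^2.  If it fails, f = g Q + p^2 S with
   Q = g^(p-1) mod p, and Q(theta) / p is an integral element outside Z[theta]. *)
From HB Require Import structures.
Require Import Defs.
From mathcomp Require Import all_boot all_order all_algebra all_field.
From mathcomp Require Import ring zify.

Set Implicit Arguments.
Unset Strict Implicit.
Unset Printing Implicit Defensive.

Import Order.TTheory GRing.Theory Num.Theory.

Local Open Scope ring_scope.

Local Notation redp q := (map_poly (intr : int -> 'F_q)).

(** * Evaluation of integer polynomials and reduction modulo a prime *)

Definition eval_int (R : comNzRingType) (a : R) : {poly int} -> R :=
  horner_eval a \o map_poly intr.

HB.instance Definition _ (R : comNzRingType) (a : R) :=
  GRing.RMorphism.copy (eval_int a) (horner_eval a \o map_poly intr).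

Lemma eval_intC (R : comNzRingType) (a : R) c : eval_int a c%:P = c%:~R.
Proof. by rewrite /eval_int /= map_polyC /horner_eval hornerC. Qed.

Lemma eval_intX (R : comNzRingType) (a : R) : eval_int a 'X = a.
Proof. by rewrite /eval_int /= map_polyX /horner_eval hornerX. Qed.

Lemma eval_int_ord_sum (R : comNzRingType) (theta : R) (c : {poly int}) n :
  (size c <= n)%N -> eval_int theta c = \sum_(i < n) theta ^+ i *~ c`_i.
Proof.
move=> le_cn; have {1}-> : c = \poly_(i < n) c`_i.
  apply/polyP=> i; rewrite coef_poly; case: ltnP => // le_ni.
  by rewrite nth_default // (leq_trans le_cn).
rewrite poly_def rmorph_sum; apply: eq_bigr => i _.
by rewrite -mul_polyC rmorphM rmorphXn /= eval_intC eval_intX mulrzl.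
Qed.

Lemma rat_ext_natr_eq0 (L : fieldExtType rat) n : (n%:R == 0 :> L) = (n == 0)%N.
Proof. by rewrite -scaler_nat scaler_eq0 oner_eq0 orbF pnatr_eq0. Qed.

(** Write [g = h * gcdp g a]. Separability makes [h] coprime to the gcd, hence to [a]; since [h]
    divides [a ^+ n], it is a unit. *)
Lemma separable_dvdp_exp (F : fieldType) (g a : {poly F}) n :
  separable_poly g -> g %| a ^+ n -> g %| a.
Proof.
move=> sep_g gan.
have /dvdpP[h Dg] : gcdp g a %| g := dvdp_gcdl g a.
have hd : coprimep h (gcdp g a).
  by apply: separable_coprime sep_g _; rewrite -Dg.
have ha : coprimep h a.
  apply/coprimepP=> d dh da; apply: (coprimepP _ _ hd) => //.
  by rewrite dvdp_gcd da andbT Dg dvdp_mulr.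
have h1 : h %| 1.
  rewrite -(Gauss_dvdpl 1 (coprimep_expr n ha)) mul1r.
  by apply: dvdp_trans gan; rewrite Dg dvdp_mulIl.
apply: dvdp_trans (dvdp_gcdr g a).
by rewrite {1}Dg -[X in _ %| X]mul1r dvdp_mul.
Qed.

Lemma redp_eq0 q (a : {poly int}) :
  prime q -> redp q a = 0 -> exists c, a = q%:R * c.
Proof.
move=> pq a0; exists (\poly_(i < size a) (a`_i %/ q)%Z).
apply/polyP=> i; rewrite mulr_natl coefMn coef_poly.
case: ltnP => [_|/leq_sizeP->//]; last by rewrite mul0rn.
have /(congr1 (fun u : {poly 'F_q} => u`_i)) := a0.
rewrite coef_map coef0 /= => /eqP; rewrite -(dvdz_pcharf (pchar_Fp pq)) => /divzK {1}<-.
by rewrite -mulr_natr natz.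
Qed.

Lemma redp_surj q (u : {poly 'F_q}) : prime q -> exists a, u = redp q a.
Proof.
move=> pq; exists (\poly_(i < size u) Posz (nth 0%R u i)).
apply/polyP=> i; rewrite coef_map coef_poly; case: ltnP => [_|/leq_sizeP->//] /=.
by rewrite -[LHS]natr_Zp pmulrn.
Qed.

Lemma redp_nat0 q : prime q -> redp q q%:R = 0.
Proof. by move=> pq; rewrite rmorph_nat -polyC_natr pchar_Fp_0. Qed.

(** Dedekind's criterion at [q], in the case where all irreducible factors of [f] mod [q] have the
    same multiplicity [e]; [g] lifts their product. *)
Definition dedekind_at (q : nat) (f : {poly int}) : Prop :=
  exists g F e, [/\ (0 < e)%N, f = g ^+ e + q%:R * F,
    separable_poly (redp q g) & coprimep (redp q g) (redp q F)].

(** * Z[theta] among the integral elements of Q(theta) *)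

Section Root.
Variables (L : fieldExtType rat) (theta : L) (f : {poly int}).
Hypotheses (f_monic : f \is monic).
Hypothesis (f_irr : irreducible_poly (map_poly intr f : {poly rat})).
Hypothesis f_root : root (map_poly intr f) theta.

Local Notation ev := (eval_int theta).

Lemma eval_int_rat (a : {poly int}) :
  ev a = (map_poly (in_alg L) (map_poly intr a : {poly rat})).[theta].
Proof.
rewrite /eval_int /= /horner_eval -map_poly_comp /=; congr _.[_].
by apply: eq_map_poly => z /=; rewrite scaler_int.
Qed.

Lemma eval_int_root : ev f = 0.
Proof. exact/rootP. Qed.

(** A nonzero [a] of smaller degree would be coprime to the irreducible [f] over the rationals, and
    a Bezout relation evaluated at [theta] would give 0 = 1. *)
Lemma eval_int_inj (a : {poly int}) : (size a < size f)%N -> ev a = 0 -> a = 0.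
Proof.
move=> a_small a0; apply/eqP/negPn/negP => nz_a.
have nz_ar : map_poly intr a != 0 :> {poly rat}.
  by rewrite map_poly_eq0_id0 // intr_eq0 lead_coef_eq0.
have := irreducible_poly_coprime (map_poly intr a) f_irr.
have -> : map_poly intr f %| (map_poly intr a : {poly rat}) = false.
  apply: contraTF a_small => /(dvdp_leq nz_ar).
  by rewrite !size_map_inj_poly // -?leqNgt //; apply: intr_inj.
move=> /Bezout_eq1_coprimepP[[u v] /=].
move=> /(congr1 (fun w => (map_poly (in_alg L) w).[theta])).
rewrite rmorph1 rmorphD !rmorphM /= hornerD !hornerM -!eval_int_rat eval_int_root a0.
by rewrite !mulr0 addr0 hornerC => /esym/eqP; rewrite oner_eq0.
Qed.

Lemma eval_int_dvd (a : {poly int}) : ev a = 0 -> exists c, a = f * c.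
Proof.
move=> a0; have Da := Pdiv.RingMonic.rdivp_eq f_monic a.
exists (Pdiv.CommonRing.rdivp a f); rewrite {1}Da mulrC.
rewrite [X in _ + X]eval_int_inj ?addr0 //.
  by rewrite Pdiv.CommonRing.ltn_rmodpN0 ?monic_neq0.
by move: a0; rewrite {1}Da rmorphD rmorphM /= eval_int_root mulr0 add0r.
Qed.

Lemma integral_eval_int (a : {poly int}) : integralOver (intr : int -> L) (ev a).
Proof.
apply: integral_horner; last by exists f.
by apply/integral_poly => i; rewrite coef_map; apply: integral_id.
Qed.

(* If [z] is integral and [z * ev g = ev a], clearing denominators in a monic
   equation of [z] shows that a power of [a] lies in the ideal [(f, g)]. *)
Lemma integral_quotient_dvd (z : L) (a g : {poly int}) :
    integralOver (intr : int -> L) z -> z * ev g = ev a ->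
  exists n c d, a ^+ n = f * c + g * d.
Proof.
move=> [P P_monic /rootP Pz] zg.
pose n := (size P).-1.
have szP : size P = n.+1 by rewrite /n prednK // lt0n size_poly_eq0 monic_neq0.
(* [a ^+ n + g * D] is the homogenised [P], that is, g^n P(a/g). *)
pose D := \sum_(i < n) (P`_i)%:~R * a ^+ i * g ^+ (n - i.+1).
have [c Dc] : exists c, a ^+ n + g * D = f * c.
  apply: eval_int_dvd.
  have -> : a ^+ n + g * D = \sum_(i < n.+1) (P`_i)%:~R * a ^+ i * g ^+ (n - i).
    rewrite big_ord_recr /= subnn expr0 mulr1.
    have -> : P`_n = 1 by move/monicP: P_monic; rewrite /lead_coef.
    rewrite mul1r addrC mulr_sumr; congr (_ + _); apply: eq_bigr => i _.
    by rewrite mulrCA -exprS -subSn.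
  rewrite rmorph_sum /=.
  transitivity (\sum_(i < n.+1) (P`_i)%:~R * z ^+ i * ev g ^+ n).
    apply: eq_bigr => i _; rewrite !rmorphM !rmorphXn /= -zg rmorph_int.
    by rewrite exprMn -!mulrA -exprD subnKC // -ltnS.
  have DP : (map_poly intr P).[z] = \sum_(i < n.+1) (P`_i)%:~R * z ^+ i.
    rewrite horner_coef size_map_poly_id0 ?szP; last first.
      by rewrite (monicP P_monic) rmorph1 oner_eq0.
    by apply: eq_bigr => i _; rewrite coef_map.
  by rewrite -mulr_suml -DP Pz mul0r.
by exists n, c, (- D); rewrite mulrN -Dc addrK.
Qed.

(** If [ev a / q] is integral, then [g ^+ j] divides [a] mod [q] for all [j <= e], by induction.
    With [a = b * g ^+ j + q * c], an integral [z] satisfies [z * ev g = - ev (F * b)], so [g]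
    divides a power of [F * b] mod [q]. As [g] is separable and coprime to [F], it divides [b]. *)
Lemma dedekind_at_dvd q (x : L) (a : {poly int}) :
    prime q -> dedekind_at q f -> integralOver (intr : int -> L) x ->
    ev a = q%:R * x ->
  redp q f %| redp q a.
Proof.
move=> pq [g [F [e [e_gt0 Df sep_g co_gF]]]] int_x ax.
have Dfq : redp q f = redp q g ^+ e.
  by rewrite Df rmorphD rmorphM /= redp_nat0 // mul0r addr0 rmorphXn.
suffices gja j : (j <= e)%N -> redp q g ^+ j %| redp q a by rewrite Dfq gja.
elim: j => [|j IHj] lt_je; first by rewrite expr0 dvd1p.
have /dvdpP[b' Db'] := IHj (ltnW lt_je).
have [b Db] := redp_surj b' pq; rewrite {b'}Db in Db'.
have [|c Dc] := @redp_eq0 q (a - b * g ^+ j) pq.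
  by rewrite rmorphB rmorphM rmorphXn /= Db' subrr.
(* Since [g ^+ e = - q F] at [theta], [z * ev g] loses its denominator [q]. *)
pose z := (x - ev c) * ev g ^+ (e - j.+1).
have int_z : integralOver (intr : int -> L) z.
  apply: integral_mul; first exact: integral_sub int_x (integral_eval_int c).
  by rewrite -rmorphXn; apply: integral_eval_int.
have nz_q : q%:R != 0 :> L by rewrite rat_ext_natr_eq0 -lt0n prime_gt0.
have zg : z * ev g = ev (- (F * b)).
  have qxc : q%:R * (x - ev c) = ev b * ev g ^+ j.
    rewrite mulrBr -ax -(rmorph_nat ev) -rmorphM -rmorphB -Dc.
    by rewrite opprB addrC subrK rmorphM rmorphXn.
  have ge : ev g ^+ e = - (q%:R * ev F).
    apply/eqP; rewrite -addr_eq0 -(rmorph_nat ev) -rmorphM -rmorphXn -rmorphD -Df.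
    exact: f_root.
  apply: (mulfI nz_q); rewrite /z -mulrA -exprSr -subSn // subSS mulrA qxc -mulrA.
  by rewrite -exprD subnKC 1?ltnW // ge rmorphN rmorphM; ring.
have [n [c' [d Dn]]] := integral_quotient_dvd int_z zg.
have gFb : redp q g %| redp q (- (F * b)).
  apply: (@separable_dvdp_exp _ _ _ n) => //.
  rewrite -rmorphXn Dn rmorphD !rmorphM /= Dfq dvdp_add ?dvdp_mulIl //.
  by rewrite dvdp_mulr // dvdp_exp.
rewrite Db' exprS dvdp_mul2r ?expf_neq0 ?separable_poly_neq0 //.
by move: gFb; rewrite rmorphN rmorphM dvdpNr Gauss_dvdpr.
Qed.

End Root.

(** * From the criterion at every prime to monogenicity *)

Section Criterion.
Variables (L : fieldExtType rat) (theta : L) (f : {poly int}).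
Hypotheses (f_monic : f \is monic).
Hypothesis (f_irr : irreducible_poly (map_poly intr f : {poly rat})).
Hypothesis f_root : root (map_poly intr f) theta.
Hypothesis f_ded : forall q, prime q -> dedekind_at q f.

Local Notation ev := (eval_int theta).

Lemma dedekind_div_prime q (x : L) (a : {poly int}) :
    prime q -> integralOver (intr : int -> L) x -> ev a = q%:R * x ->
  exists c, x = ev c.
Proof.
move=> pq int_x ax.
have /dvdpP[u' Du] := dedekind_at_dvd f_monic f_irr f_root pq (f_ded pq) int_x ax.
have [u Du'] := redp_surj u' pq; rewrite {u'}Du' in Du.
have [|c Dc] := @redp_eq0 q (a - u * f) pq.
  by rewrite rmorphB rmorphM /= Du subrr.
have nz_q : q%:R != 0 :> L by rewrite rat_ext_natr_eq0 -lt0n prime_gt0.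
exists c; apply: (mulfI nz_q); rewrite -ax -(rmorph_nat ev) -rmorphM -Dc.
by rewrite rmorphB rmorphM /= [X in _ * X](eval_int_root f_root) mulr0 subr0.
Qed.

(** The denominator loses one prime factor at a time: the prime case is applied to
    [(n %/ pdiv n) * x]. *)
Lemma dedekind_div n (x : L) (a : {poly int}) :
    (0 < n)%N -> integralOver (intr : int -> L) x -> ev a = n%:R * x ->
  exists c, x = ev c.
Proof.
elim/ltn_ind: n x a => n IHn x a; case: (leqP n 1%N) => [n_le1|n_gt1] n_gt0 int_x ax.
  have n1 : n = 1%N by lia.
  by move: ax; rewrite n1 mulr1n mul1r => <-; exists a.
have pq := pdiv_prime n_gt1; have Dn := divnK (pdiv_dvd n).
have m_gt0 : (0 < n %/ pdiv n)%N by rewrite divn_gt0 ?pdiv_gt0 ?pdiv_leq.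
have [||c Dc] := @dedekind_div_prime _ ((n %/ pdiv n)%:R * x) a pq.
- by apply: integral_mul => //; apply: integral_nat.
- by rewrite ax -{1}Dn natrM mulrA [_ * _%:R]mulrC.
exact: (IHn _ (ltn_Pdiv (prime_gt1 pq) n_gt0) _ _ m_gt0 int_x (esym Dc)).
Qed.

End Criterion.

Lemma dedekind_monogenic (f : {poly int}) :
    f \is monic -> (2 <= (size f).-1)%N ->
    irreducible_poly (map_poly intr f : {poly rat}) ->
    (forall q, prime q -> dedekind_at q f) ->
  monogenic f.
Proof.
move=> f_monic f_deg f_irr f_ded; split=> // L theta f_root.
have f_gt0 : (0 < size f)%N by rewrite lt0n size_poly_eq0 monic_neq0.
split.
- move=> i; split; first by rewrite rpredX ?memv_adjoin.
  have := integral_eval_int f_monic f_root 'X^i.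
  by rewrite rmorphXn /= eval_intX.
- move=> c c0 i.
  (* [insub] turns the family [c], indexed by ordinals, into coefficients indexed by naturals. *)
  pose a := \poly_(j < (size f).-1) (if insub j is Some k then c k else 0).
  have Da j : a`_(val j) = c j by rewrite coef_poly ltn_ord valK.
  have a0 : a = 0.
    apply: (eval_int_inj f_irr f_root).
      by rewrite -[X in (_ < X)%N](prednK f_gt0) ltnS size_poly.
    rewrite (@eval_int_ord_sum _ _ _ (size f).-1) ?size_poly // -[RHS]c0.
    by apply: eq_bigr => j _; rewrite Da.
  by rewrite -Da a0 coef0.
- move=> x [x_in int_x].
  have /Fadjoin1_polyP[P Dx] : x \in <<1; theta>>%VS by [].
  have [a [d nz_d DP]] := rat_poly_scale P.
  have [b Db] : exists b, eval_int theta b = `|d|%N%:R * x.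
    have Da : eval_int theta a = d%:~R * x.
      rewrite Dx eval_int_rat DP linearZ /= hornerZ mulrA.
      rewrite -[d%:~R](rmorph_int (in_alg L)) -rmorphM mulfV ?intr_eq0 //.
      by rewrite rmorph1 mul1r.
    (* The sign of the denominator is absorbed into the numerator. *)
    case: (intP d) Da => [|n|n] Da; first by exists a; rewrite Da.
      by exists a; rewrite Da.
    by exists (- a); rewrite rmorphN /= Da mulrNz mulNr opprK.
  have [|c Dc] := dedekind_div f_monic f_irr f_root f_ded _ int_x Db.
    by rewrite absz_gt0.
  (* The remainder modulo the monic [f] has integer coefficients and the same value at [theta]. *)
  pose r := Pdiv.CommonRing.rmodp c f.
  exists (fun i => r`_i); rewrite -eval_int_ord_sum.
    rewrite Dc {1}(Pdiv.RingMonic.rdivp_eq f_monic c) rmorphD rmorphM /=.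
    by rewrite [X in _ * X](eval_int_root f_root) mulr0 add0r.
  by rewrite -ltnS prednK // Pdiv.CommonRing.ltn_rmodpN0 ?monic_neq0.
Qed.

(** * The trinomials: irreducibility and separability *)

(** Any coefficient ring is allowed, so that reductions mod q are again trinomials; [trinom 1 b] is
    the quadratic g of the overview, and [trinom n b] is g(X^n). *)
Definition trinom (R : comNzRingType) (n : nat) (b : R) : {poly R} :=
  'X^(2 * n) + b%:P * 'X^n + b%:P.

Lemma trinomial_GE p b : trinomial_G p b = trinom p b.
Proof. by rewrite /trinomial_G /trinom mul_polyC. Qed.

Lemma map_trinom (R S : comNzRingType) (h : {rmorphism R -> S}) n b :
  map_poly h (trinom n b) = trinom n (h b).
Proof. by rewrite /trinom !rmorphD rmorphM /= !map_polyXn !map_polyC. Qed.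

Lemma size_trinom_tail (R : comNzRingType) n (b : R) :
  (size (b%:P * 'X^n + b%:P)%R <= n.+1)%N.
Proof.
rewrite mul_polyC (leq_trans (size_polyD _ _)) // geq_max.
rewrite (leq_trans (size_scale_leq _ _)) ?size_polyXn //.
by rewrite (leq_trans (size_polyC_leq1 _)).
Qed.

Lemma size_trinom (R : comNzRingType) n (b : R) :
  (0 < n)%N -> size (trinom n b) = (2 * n).+1.
Proof.
move=> n_gt0; rewrite /trinom -addrA size_polyDl ?size_polyXn //.
by rewrite (leq_ltn_trans (size_trinom_tail _ _)) // ltnS; lia.
Qed.

Lemma trinom_monic (R : comNzRingType) n (b : R) :
  (0 < n)%N -> trinom n b \is monic.
Proof.
move=> n_gt0; rewrite monicE /trinom -addrA lead_coefDl ?lead_coefXn //.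
by rewrite size_polyXn (leq_ltn_trans (size_trinom_tail _ _)) // ltnS; lia.
Qed.

(** Eisenstein at [q]: the constant term is [q] itself. *)
Lemma trinom_irreducible q n : prime q -> (0 < n)%N ->
  irreducible_poly (map_poly intr (trinom n q%:Z) : {poly rat}).
Proof.
move=> pq n_gt0; apply/irreducible_rat_int.
have coefT i : (trinom n q%:Z)`_i =
    (i == (2 * n)%N)%:R + (q%:Z * (i == n)%:R + (if i == 0 then q%:Z else 0)).
  by rewrite /trinom -addrA !coefD mul_polyC coefZ !coefXn coefC.
apply: (eisenstein_crit pq); rewrite ?size_trinom //.
- by rewrite eqSS muln_eq0 /= -lt0n.
- rewrite (monicP (trinom_monic _ n_gt0)) dvdzE /= dvdn1.
  by rewrite neq_ltn prime_gt1 ?orbT.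
- rewrite coefT eqxx ![0%N == _]eq_sym muln_eq0 /= [n == 0%N]eqn0Ngt n_gt0 /=.
  rewrite mulr0 !add0r.
  rewrite dvdzE /= ?abszX.
  have -> : (q ^+ 2)%R = (q * q)%N by [].
  rewrite gtnNdvd ?prime_gt0 // -[X in (X < _)%N]muln1.
  by rewrite ltn_pmul2l ?prime_gt1 ?prime_gt0.
- move=> i; rewrite /= coefT => lt_i; rewrite ltn_eqF // add0r.
  by rewrite rpredD ?dvdz_mulr ?dvdzz //; case: ifP; rewrite ?dvdzz ?dvdz0.
Qed.

Lemma trinom_separable (F : fieldType) n (b : F) :
  n%:R != 0 :> F -> b != 0 -> b ^+ 2 - 4 * b != 0 -> separable_poly (trinom n b).
Proof.
move=> nz_n nz_b nz_D; rewrite separable_poly.unlock.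
have n_gt0 : (0 < n)%N by rewrite lt0n; apply: contraNneq nz_n => ->.
set f := trinom n b; pose Y : {poly F} := 'X^n.
have DX : 'X * f^`() = n%:R * Y * (2 * Y + b%:P).
  rewrite /f /trinom !derivD mul_polyC derivZ derivC !derivXn -!mul_polyC addr0.
  rewrite mulrDr mulrCA !mulrnAr -!exprS !prednK ?muln_gt0 // /Y.
  by rewrite mulnC exprM expr2 -[in _ *+ (n * 2)]mulr_natl natrM; ring.
apply/Bezout_coprimepP.
(* The Bezout coefficients come from [f - Y * (Y + b) = b] and [(2 * Y + b) ^+ 2 - 4 * f = b ^+ 2 -
   4 * b], combined with [DX]. *)
exists ((2 * Y + b%:P) ^+ 2 * n%:R - 4 * n%:R * b%:P,
        - (2 * Y + b%:P) * (Y + b%:P) * 'X) => /=.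
have -> : ((2 * Y + b%:P) ^+ 2 * n%:R - 4 * n%:R * b%:P) * f +
   - (2 * Y + b%:P) * (Y + b%:P) * 'X * f^`() = (n%:R * b * (b ^+ 2 - 4 * b))%:P.
  rewrite -[_ * 'X * _]mulrA DX /f /trinom mulnC exprM -/Y.
  by rewrite !(rmorphM, rmorphB, rmorphXn, rmorph_nat) /=; ring.
by rewrite polyC_eqp1 !mulf_neq0.
Qed.

(** * Powers of X modulo the quadratic *)

Lemma expr_modE (R : comNzRingType) (x c g k : R) m j :
  x ^+ m = c + g * k -> exists l, x ^+ (m * j) = c ^+ j + g * l.
Proof.
move=> Dx; exists (k * \sum_(i < j) (x ^+ m) ^+ (j.-1 - i) * c ^+ i).
have gk : g * k = x ^+ m - c by rewrite Dx addrAC subrr add0r.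
by rewrite mulrA gk -subrXX addrC subrK exprM.
Qed.

(** The roots of g are sqrt(b) times primitive roots of unity, of order 8 for [b = 2] and 12 for
    [b = 3]. For [p] prime to that order, the p-th power of such a root of unity is, up to sign,
    itself or its conjugate; so [w] is b^((p-1)/2) up to sign. *)
Lemma expX_mod_trinom b p :
    b = 2 /\ odd p \/ b = 3 /\ odd p /\ ~~ (3 %| p)%N ->
  exists (w : int) y Q, [/\ 'X^p = w%:P * y + trinom 1 b * Q,
    w ^+ 2 = b ^+ (p - 1) & y = 'X \/ y = - b%:P - 'X].
Proof.
(* Reduction to the remainder [r] of [p] modulo [m]: each factor X^m contributes [c] to [w], and
   [c ^+ 2 = b ^+ m]. *)
have red m r (c w : int) y Q K : p = (m * (p %/ m) + r)%N -> (0 < r)%N ->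
    'X^m = c%:P + trinom 1 b * K -> c ^+ 2 = b ^+ m ->
    'X^r = w%:P * y + trinom 1 b * Q -> w ^+ 2 = b ^+ (r - 1) ->
    y = 'X \/ y = - b%:P - 'X ->
  exists (w : int) y Q, [/\ 'X^p = w%:P * y + trinom 1 b * Q,
    w ^+ 2 = b ^+ (p - 1) & y = 'X \/ y = - b%:P - 'X].
  move=> Dp r_gt0 Xm c2 Xr w2 Hy; have [l Xmj] := expr_modE (p %/ m) Xm.
  exists (c ^+ (p %/ m) * w), y, (c%:P ^+ (p %/ m) * Q + l * 'X^r); split=> //.
    rewrite {1}Dp exprD Xmj mulrDl {1}Xr rmorphM rmorphXn /=; ring.
  by rewrite exprMn exprAC c2 -exprM w2 -exprD {2}Dp addnBA.
have polyC_int (z : int) : z%:P = z%:~R :> {poly int} by rewrite -(rmorph_int polyC) intz.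
case=> [[Db odd_p]|[Db [odd_p p3]]]; rewrite {}Db /trinom expr1 muln1 !polyC_int in red *.
(* X^8 - 16 = (X^4 - 4)(X^4 + 4), and X^4 + 4 = (X^2 + 2X + 2)(X^2 - 2X + 2). *)
- have X8 : 'X^8 = 16%:P + ('X^2 + 2%:~R * 'X + 2%:~R) *
      (('X^4 - 4) * ('X^2 - 2 * 'X + 2)) :> {poly int}.
    by rewrite !polyC_int; ring.
  have : p = (8 * (p %/ 8) + 1)%N \/ p = (8 * (p %/ 8) + 3)%N \/
         p = (8 * (p %/ 8) + 5)%N \/ p = (8 * (p %/ 8) + 7)%N by lia.
  case=> [|[|[|]]] Dp.
  (* In each case [w] is b^((r-1)/2) up to sign, and [Q] is the quotient of X^r - w y by g. *)
  + by apply: (red _ _ 16 1 'X 0 _ Dp _ X8);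
      [done|ring|rewrite !polyC_int; ring|ring|left].
  + by apply: (red _ _ 16 (-2) (- 2 - 'X) ('X - 2) _ Dp _ X8);
      [done|ring|rewrite !polyC_int; ring|ring|right].
  + by apply: (red _ _ 16 (-4) 'X ('X * ('X^2 - 2 * 'X + 2)) _ Dp _ X8);
      [done|ring|rewrite !polyC_int; ring|ring|left].
  + by apply: (red _ _ 16 8 (- 2 - 'X)
      ('X^3 * ('X^2 - 2 * 'X + 2) - 4 * ('X - 2)) _ Dp _ X8);
      [done|ring|rewrite !polyC_int; ring|ring|right].
(* X^12 - 729 = (X^6 - 27)(X^6 + 27), and X^6 + 27 = (X^2 + 3)(X^2 + 3X + 3)(X^2 - 3X + 3). *)
- have X12 : 'X^12 = 729%:P + ('X^2 + 3%:~R * 'X + 3%:~R) *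
      (('X^6 - 27) * (('X^2 + 3) * ('X^2 - 3 * 'X + 3))) :> {poly int}.
    by rewrite !polyC_int; ring.
  have : p = (12 * (p %/ 12) + 1)%N \/ p = (12 * (p %/ 12) + 5)%N \/
         p = (12 * (p %/ 12) + 7)%N \/ p = (12 * (p %/ 12) + 11)%N by lia.
  case=> [|[|[|]]] Dp.
  + by apply: (red _ _ 729 1 'X 0 _ Dp _ X12);
      [done|ring|rewrite !polyC_int; ring|ring|left].
  + by apply: (red _ _ 729 (-9) (- 3 - 'X) ('X^3 - 3 * 'X^2 + 6 * 'X - 9) _ Dp _ X12);
      [done|ring|rewrite !polyC_int; ring|ring|right].
  + by apply: (red _ _ 729 (-27) 'X ('X * (('X^2 + 3) * ('X^2 - 3 * 'X + 3))) _ Dp _ X12);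
      [done|ring|rewrite !polyC_int; ring|ring|left].
  + by apply: (red _ _ 729 243 (- 3 - 'X)
      ('X^5 * (('X^2 + 3) * ('X^2 - 3 * 'X + 3))
       - 27 * ('X^3 - 3 * 'X^2 + 6 * 'X - 9)) _ Dp _ X12);
      [done|ring|rewrite !polyC_int; ring|ring|right].
Qed.

Lemma trinom_mod b p (w : int) y Q :
    'X^p = w%:P * y + trinom 1 b * Q -> y = 'X \/ y = - b%:P - 'X ->
  exists K, trinom p b = trinom 1 b * K + (b * (1 - w))%:P * (w%:P * y + (1 + w)%:P).
Proof.
set g := trinom 1 b => DX Hy.
(* An exact identity for both choices of [y], since g is invariant under X -> -b - X. *)
have gy : y ^+ 2 = g - b%:P * y - b%:P.
  by rewrite /g /trinom muln1 expr1; case: Hy => ->; ring.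
exists (w%:P ^+ 2 + 2 * w%:P * y * Q + g * Q ^+ 2 + b%:P * Q).
rewrite {1}/trinom mulnC exprM DX.
rewrite !(rmorphM, rmorphB, rmorphD, rmorph1) /=.
transitivity (w%:P ^+ 2 * y ^+ 2 + 2 * w%:P * y * g * Q + (g * Q) ^+ 2
              + b%:P * (w%:P * y + g * Q) + b%:P); first by ring.
by rewrite gy; ring.
Qed.

(** * An integral element outside Z[theta] *)

(** At a root of [f], [g * Q = - p ^ 2 * S]. Multiplying the formula for [Q] by [Q] and dividing by
    [p ^ 2] gives a monic quadratic equation for [x = Q / p] over Z[theta], so [x] is integral. *)
Lemma not_monogenic_of_sqr (f g Q M S : {poly int}) p n : (1 < p)%N ->
    f = g * Q + (p ^ 2)%:R * S -> Q = g ^+ n.+1 + p%:R * M ->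
    (size Q < size f)%N -> (forall c, Q <> p%:R * c) ->
  ~ monogenic f.
Proof.
move=> p_gt1 Df DQ szQ Qp [f_monic f_deg f_irr f_basis].
have [L _ [theta f_root' _]] := irredp_FAdjoin f_irr.
have f_root : root (map_poly intr f) theta.
  by rewrite /root -[_.[_]]/(eval_int theta f) eval_int_rat.
have [_ _ span] := f_basis L theta f_root.
pose ev := eval_int theta; pose x := ev Q / p%:R.
have nz_p : p%:R != 0 :> L by rewrite rat_ext_natr_eq0 -lt0n ltnW.
have Dx : p%:R * x = ev Q by rewrite mulrC divfK.
have x2 : x ^+ 2 = ev M * x - ev S * ev g ^+ n.
  have gQ : ev g * ev Q = - (p%:R ^+ 2 * ev S).
    apply/eqP; rewrite -addr_eq0 -natrX /ev -(rmorph_nat (eval_int theta)).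
    rewrite -!rmorphM -rmorphD -Df.
    exact: f_root.
  have evQ : ev Q = ev g ^+ n.+1 + p%:R * ev M.
    by rewrite /ev {1}DQ rmorphD rmorphM rmorphXn rmorph_nat.
  have nz_p2 : p%:R ^+ 2 != 0 :> L by rewrite expf_neq0.
  apply: (mulfI nz_p2); rewrite -exprMn Dx expr2 {2}evQ.
  rewrite mulrDr exprS mulrA [ev Q * ev g]mulrC gQ -Dx; ring.
have int_x : integralOver (intr : int -> L) x.
  have int_ev := integral_eval_int f_monic f_root.
  pose P : {poly L} := 'X^2 + ((ev S * ev g ^+ n)%:P - ev M *: 'X).
  have szP : (size ((ev S * ev g ^+ n)%:P - ev M *: 'X)%R < 3)%N.
    rewrite (leq_ltn_trans (size_polyD _ _)) // gtn_max size_polyN.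
    rewrite (leq_ltn_trans (size_polyC_leq1 _)) //.
    by rewrite (leq_ltn_trans (size_scale_leq _ _)) ?size_polyX.
  apply: (@integral_root_monic _ _ _ _ P).
  - by rewrite monicE lead_coefDl ?lead_coefXn // size_polyXn.
  - rewrite /root /P !(hornerD, hornerN, hornerZ, hornerC, hornerX, hornerXn) x2.
    by apply/eqP; ring.
  - apply/integral_poly => i; rewrite /P !coefD coefXn coefN coefZ coefC coefX.
    apply: integral_add; first exact: integral_nat.
    apply: integral_sub; last first.
      by apply: integral_mul; [apply: int_ev | apply: integral_nat].
    case: ifP => _; last exact: integral0.
    by rewrite /ev -rmorphXn -rmorphM; apply: int_ev.
have x_in : x \in <<1; theta>>%AS.
  rewrite rpred_div // ?rpred_nat // /ev eval_int_rat.
  by apply/Fadjoin1_polyP; exists (map_poly intr Q).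
have [c Dc] := span x (conj x_in int_x).
pose a := \poly_(j < (size f).-1) (if insub j is Some k then c k else 0).
have f_gt0 : (0 < size f)%N by rewrite lt0n size_poly_eq0 monic_neq0.
have sza : (size a < size f)%N.
  by rewrite -[X in (_ < X)%N](prednK f_gt0) ltnS size_poly.
(* If [x] were [ev a] with [a] of degree below that of [f], then [Q - p * a] would vanish at [theta]
   and so be zero. *)
apply: (Qp a); apply/eqP; rewrite -subr_eq0; apply/eqP.
apply: (eval_int_inj f_irr f_root).
  rewrite (leq_ltn_trans (size_polyD _ _)) // gtn_max szQ size_polyN.
  by rewrite mulr_natl -scaler_nat (leq_ltn_trans (size_scale_leq _ _) sza).
rewrite rmorphB rmorphM rmorph_nat /= -/ev -Dx Dc -mulrBr.
rewrite /ev (@eval_int_ord_sum _ _ _ (size f).-1) ?size_poly // -sumrB big1 ?mulr0 // => j _.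
by rewrite coef_poly ltn_ord valK subrr.
Qed.

(** * The trinomial at the prime p *)

Lemma trinom_frobenius p (c : 'F_p) : prime p -> trinom p c = trinom 1 c ^+ p.
Proof.
move=> pp; have cp : [pchar {poly 'F_p}].-nat p.
  by rewrite pnatE // pchar_poly pchar_Fp.
rewrite /trinom expr1 muln1 !exprDn_pchar // -exprM exprMn -polyC_exp.
have -> : c ^+ p = c by have := expf_card c; rewrite card_Fp.
by [].
Qed.

(** Both directions rest on this expansion: [v] mod [p] decides the congruence on [b ^+ (p - 1)] and
    also the criterion at [p]. Here [v] is (1 - w)/p and [T] is [w * y + 1 + w]. *)
Lemma trinom_decomp p b :
    prime p -> b%:~R != 0 :> 'F_p -> (4 - b)%:~R != 0 :> 'F_p ->
    b = 2 /\ odd p \/ b = 3 /\ odd p /\ ~~ (3 %| p)%N ->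
  exists (v : int) M T, [/\ b ^+ (p - 1) = (1 - p%:Z * v) ^+ 2,
    trinom p b = trinom 1 b * (trinom 1 b ^+ p.-1 + p%:R * M)
                 + p%:R * ((b * v)%:P * T),
    coprimep (redp p (trinom 1 b)) (redp p T) & (size T <= 2)%N].
Proof.
move=> pp nz_b nz_4b hb; have [w [y [Q [DX w2 Hy]]]] := expX_mod_trinom hb.
have [K Df] := trinom_mod DX Hy; set g := trinom 1 b in DX Df *.
set T := w%:P * y + _ in Df.
pose yp := redp p y; pose bp : 'F_p := b%:~R; pose wp : 'F_p := w%:~R.
have Dg : redp p g = trinom 1 bp by rewrite map_trinom.
have Dfp : redp p (trinom p b) = redp p g ^+ p.
  by rewrite map_trinom Dg trinom_frobenius.
have DT : redp p T = wp%:P * yp + (1 + wp)%:P.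
  by rewrite /T rmorphD rmorphM /= !map_polyC /= rmorphD.
have Hyp : yp = 'X \/ yp = - bp%:P - 'X.
  rewrite /yp; case: Hy => ->; first by left; rewrite map_polyX.
  by right; rewrite rmorphB rmorphN /= map_polyC map_polyX.
have Dbw : redp p (b * (1 - w))%:P = (bp * (1 - wp))%:P.
  by rewrite map_polyC /= rmorphM rmorphB.
have szT : (size T <= 2)%N.
  rewrite /T (leq_trans (size_polyD _ _)) // geq_max mul_polyC.
  rewrite (leq_trans (size_scale_leq _ _)) /= ?(leq_trans (size_polyC_leq1 _)) //.
  case: Hy => ->; rewrite ?size_polyX // (leq_trans (size_polyD _ _)) // geq_max.
  by rewrite !size_polyN size_polyX (leq_trans (size_polyC_leq1 _)).
(* Mod [p] the trinomial is [g ^+ p], so [g] divides b(1 - w)T, which has degree at most 1 and is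
   therefore zero. The X-coefficient of [T] is [w] up to sign, nonzero because
   [w ^+ 2 = b ^+ (p - 1)]. *)
have w1 : wp = 1.
  have : redp p g %| (bp * (1 - wp))%:P * redp p T.
    have -> : (bp * (1 - wp))%:P * redp p T = redp p g * (redp p g ^+ p.-1 - redp p K).
      rewrite [RHS]mulrBr -exprS prednK ?prime_gt0 // -Dfp -Dbw -!rmorphM -rmorphB Df.
      by rewrite addrAC subrr add0r.
    by rewrite dvdp_mulr.
  rewrite mul_polyC => gT; have : (bp * (1 - wp)) *: redp p T == 0.
    apply: contraTT gT => nz; apply: contraTN isT => /(dvdp_leq nz).
    rewrite Dg size_trinom // leqNgt ltnS (leq_trans (size_scale_leq _ _)) //.
    by rewrite (leq_trans (size_poly _ _)).
  move=> /eqP/(congr1 (fun u : {poly 'F_p} => u`_1)) /eqP.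
  rewrite coefZ DT coefD mul_polyC coefZ coefC coef0 addr0 !mulf_eq0 (negPf nz_b) subr_eq0 /=.
  have -> : (wp == 0) = false.
    apply: contraNF nz_b => /eqP wp0; move/(congr1 (intr : int -> 'F_p)): w2.
    rewrite !rmorphXn /= -/wp wp0 expr0n => /esym/eqP.
    by rewrite expf_eq0 => /andP[].
  have -> : (yp`_1 == 0) = false.
    case: Hyp => ->; rewrite ?coefD ?coefN ?coefC ?coefX /=.
      exact: oner_eq0.
    by rewrite oppr0 add0r oppr_eq0 oner_eq0.
  by rewrite !orbF => /eqP.
have [v Dv] : exists v, w = 1 - p%:Z * v.
  have /divzK Dv : (p%:Z %| 1 - w)%Z.
    by rewrite (dvdz_pcharf (pchar_Fp pp)) rmorphB -[_ w]/wp w1 subrr.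
  by exists ((1 - w) %/ p%:Z)%Z; rewrite mulrC Dv; ring.
have D1w : (b * (1 - w))%:P = p%:R * (b * v)%:P :> {poly int}.
  by rewrite Dv -polyC_natr -polyCM natz; congr _%:P; ring.
have [|M DM] := @redp_eq0 p (K - g ^+ p.-1) pp.
  have nz_g : redp p g != 0 by rewrite Dg monic_neq0 ?trinom_monic.
  apply: (mulfI nz_g); rewrite rmorphB rmorphXn /= mulrBr -exprS prednK ?prime_gt0 //.
  rewrite -Dfp mulr0 -rmorphM -rmorphB Df D1w opprD addNKr -mulrA.
  by rewrite -mulrN rmorphM /= redp_nat0 // mul0r.
exists v, M, T; split=> //; first by rewrite -w2 Dv.
  by rewrite Df D1w -DM -mulrA; ring.
(* With [w = 1] mod [p], [T] becomes y + 2, and (y + 2)(2 - b - y) = 4 - b - g(y), where g(y) =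
   g. *)
have co_eq : redp p T * (2%:P - bp%:P - yp) + redp p g = (4 - bp)%:P.
  rewrite DT w1 /yp Dg /trinom muln1 expr1 -/yp.
  rewrite !(rmorphB, rmorphD, rmorph_nat) /=.
  by case: Hyp => ->; ring.
apply/Bezout_coprimepP; exists (1, 2%:P - bp%:P - yp).
rewrite /= mul1r addrC [_ * redp p T]mulrC co_eq polyC_eqp1.
by move: nz_4b; rewrite rmorphB /=.
Qed.

Lemma not_monogenic_trinom p b v M (T : {poly int}) :
    prime p -> (2 < p)%N -> (size T <= 2)%N ->
    trinom p b = trinom 1 b * (trinom 1 b ^+ p.-1 + p%:R * M)
                 + p%:R * ((b * (p%:Z * v))%:P * T) ->
  ~ monogenic (trinom p b).
Proof.
move=> pp p_gt2 szT; set g := trinom 1 b; set Q := _ + p%:R * M => Df.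
have g_monic : g \is monic by rewrite trinom_monic.
have p_gt0 := prime_gt0 pp.
apply: (@not_monogenic_of_sqr _ g Q M ((b * v)%:P * T) p p.-2) => //.
- exact: prime_gt1.
- have Dp : (p%:Z)%:P = p%:R :> {poly int} by rewrite -natz polyC_natr.
  by rewrite Df; congr (_ + _); rewrite natrX !polyCM Dp; ring.
- by rewrite prednK // -subn1 subn_gt0 ltnW.
(* The degree of [Q] is read off [g * Q], which differs from the trinomial by a multiple of [T], of
   degree at most 1. *)
- have [->|nz_Q] := eqVneq Q 0; first by rewrite size_poly0 size_trinom.
  have : (size (g * Q)%R <= (2 * p).+1)%N.
    have -> : g * Q = trinom p b - (p%:R * (b * (p%:Z * v))%:P) * T.
      by rewrite Df -mulrA addrK.
    rewrite (leq_trans (size_polyD _ _)) // size_polyN size_trinom // geq_max leqnn /=.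
    rewrite -polyC_natr -polyCM mul_polyC (leq_trans (size_scale_leq _ _)) //.
    by rewrite (leq_trans szT); lia.
  rewrite size_monicM // (size_trinom b (isT : 0 < 1)%N) size_trinom //.
  by move: (size Q) => k; lia.
(* Mod [p], [Q] is a power of the monic [g], hence nonzero. *)
- move=> c /(congr1 (map_poly (intr : int -> 'F_p))).
  rewrite /Q rmorphD !rmorphM /= redp_nat0 // !mul0r addr0 rmorphXn /= => /eqP.
  by rewrite expf_eq0 map_trinom (negPf (monic_neq0 _)) ?trinom_monic ?andbF.
Qed.

(** With [e = p], the cofactor [F] is congruent to [b * v * T] modulo [g], and [b * v] is a unit mod
    [p]. *)
Lemma dedekind_at_trinom p b v M (T : {poly int}) :
    prime p -> b%:~R != 0 :> 'F_p -> (b ^+ 2 - 4 * b)%:~R != 0 :> 'F_p ->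
    v%:~R != 0 :> 'F_p -> coprimep (redp p (trinom 1 b)) (redp p T) ->
    trinom p b = trinom 1 b * (trinom 1 b ^+ p.-1 + p%:R * M)
                 + p%:R * ((b * v)%:P * T) ->
  dedekind_at p (trinom p b).
Proof.
move=> pp nz_b nz_D nz_v co_T Df.
exists (trinom 1 b), (M * trinom 1 b + (b * v)%:P * T), p; split.
- exact: prime_gt0.
- by rewrite Df mulrDr -exprS prednK ?prime_gt0 //; ring.
- rewrite map_trinom trinom_separable ?oner_eq0 //.
  by move: nz_D; rewrite rmorphB rmorphXn rmorphM.
- move: (trinom 1 b) co_T => g co_T.
  rewrite rmorphD !rmorphM /= coprimep_addl_mul !map_polyC -polyCM mul_polyC.
  rewrite coprimepZr //.
  by rewrite mulf_neq0.
Qed.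

(** * The criterion at the other primes *)

Lemma dedekind_at_eisenstein q n : (0 < n)%N -> dedekind_at q (trinom n q%:Z).
Proof.
move=> n_gt0; exists 'X, ('X^n + 1), (2 * n)%N; split.
- by rewrite muln_gt0.
- have Dq : (q%:Z)%:P = q%:R :> {poly int} by rewrite -natz polyC_natr.
  by rewrite /trinom Dq; ring.
- by rewrite map_polyX separable_poly.unlock derivX coprimep1.
- rewrite map_polyX rmorphD rmorph1 /= map_polyXn coprimep_sym coprimepX.
  by rewrite /root hornerD hornerC hornerXn expr0n gtn_eqF //= add0r oner_eq0.
Qed.

Lemma dedekind_at_separable q (f : {poly int}) :
  prime q -> separable_poly (redp q f) -> dedekind_at q f.
Proof.
move=> pq sep_f; exists (f - q%:R), 1, 1%N; split=> //.
- by rewrite mulr1 expr1 subrK.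
- by rewrite rmorphB /= redp_nat0 // subr0.
- by rewrite rmorph1 coprimep1.
Qed.

(** * Assembling the local conditions *)

Theorem corollary1p7 (b : int) (hb : b = 2 \/ b = 3) (p : nat)
    (hp : prime p) (hp3 : (3 <= p)%N)
    (hD : let D := b ^+ 2 - 4 * b in ~ (D = 0 %[mod p%:Z])%Z) :
  ~ monogenic (trinomial_G p b) <-> (b ^+ (p - 1) = 1 %[mod p%:Z ^+ 2])%Z.
Proof.
have p_gt0 := prime_gt0 hp.
have nz_D : (b ^+ 2 - 4 * b)%:~R != 0 :> 'F_p.
  rewrite -(dvdz_pcharf (pchar_Fp hp)); apply/negP => pD; apply: hD => /=.
  by apply/eqP; rewrite eqz_mod_dvd subr0.
have DD : b ^+ 2 - 4 * b = - (b * (4 - b)) by ring.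
have [nz_b nz_4b] : b%:~R != 0 :> 'F_p /\ (4 - b)%:~R != 0 :> 'F_p.
  by move: nz_D; rewrite DD rmorphN rmorphM oppr_eq0 mulf_eq0 negb_or => /andP[].
have hb' : b = 2 /\ odd p \/ b = 3 /\ odd p /\ ~~ (3 %| p)%N.
  have odd_p : odd p by case: (even_prime hp) => // p2; rewrite p2 in hp3.
  case: hb nz_b => [|] -> nz; [by left|right]; split=> //; split=> //.
  rewrite dvdn_prime2 //; apply: contraNneq nz => p3.
  by rewrite -p3 -(dvdz_pcharf (pchar_Fp _)).
have [v [M [T [bp Df co_T szT]]]] := trinom_decomp hp nz_b nz_4b hb'.
rewrite trinomial_GE.
(* (1 - p v)^2 - 1 = p v (p v - 2), and the last factor is -2 mod [p], a unit since [p > 2]. *)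
have -> : (b ^+ (p - 1) = 1 %[mod p%:Z ^+ 2])%Z <-> (p%:Z %| v)%Z.
  rewrite bp; split=> [/eqP|].
    rewrite eqz_mod_dvd (_ : _ - 1 = p%:Z * (v * (p%:Z * v - 2))); last by ring.
    rewrite expr2 dvdz_mul2l ?eqz_nat -?lt0n // !(dvdz_pcharf (pchar_Fp hp)).
    rewrite rmorphM rmorphB rmorphM mulf_eq0 /= -[p%:~R]/(p%:R) pchar_Fp_0 //.
    rewrite mul0r sub0r oppr_eq0.
    rewrite -[2%:~R]/(2%:R) -(dvdn_pcharf (pchar_Fp hp)) gtnNdvd ?orbF //.
  case/dvdzP=> u ->; apply/eqP; rewrite eqz_mod_dvd; apply/dvdzP.
  by exists (u * (p%:Z ^+ 2 * u - 2)); ring.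
split=> [not_mono|]; last first.
  case/dvdzP=> u Dv; rewrite Dv [u * _]mulrC in Df.
  exact: not_monogenic_trinom hp hp3 szT Df.
apply/negPn/negP => nz_v; apply: not_mono.
have [q [pq Db]] : exists q, prime q /\ b = q%:Z.
  by case: hb => ->; [exists 2%N | exists 3%N].
apply: dedekind_monogenic.
- exact: trinom_monic.
- by rewrite size_trinom //=; lia.
- by rewrite Db; apply: trinom_irreducible.
move=> r pr; have [->|r_p] := eqVneq r p.
  apply: dedekind_at_trinom co_T Df => //.
  by rewrite -(dvdz_pcharf (pchar_Fp hp)).
have [->|r_q] := eqVneq r q; first by rewrite Db; apply: dedekind_at_eisenstein.
apply: dedekind_at_separable => //; rewrite map_trinom.
have r_ndvd s : prime s -> r != s -> s%:R != 0 :> 'F_r.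
  by move=> ps r_s; rewrite -(dvdn_pcharf (pchar_Fp pr)) dvdn_prime2.
have nz_bq : b%:~R != 0 :> 'F_r by rewrite Db; apply: r_ndvd.
apply: trinom_separable; [exact: r_ndvd | exact: nz_bq |].
have -> : b%:~R ^+ 2 - 4 * b%:~R = (b ^+ 2 - 4 * b)%:~R :> 'F_r.
  by rewrite rmorphB rmorphXn rmorphM.
(* The factor [4 - b] is [b] itself when [b = 2] and 1 when [b = 3], so it brings no new prime. *)
rewrite DD rmorphN rmorphM oppr_eq0 mulf_neq0 //.
by case: hb nz_bq => ->; rewrite ?oner_eq0.
Qed.
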